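(* On each Maharam algebra $\mathbb{B}$ we have $\mathcal{O}_{\mathrm{lsi}}=\mathcal{O}_{\lambda_{\mathrm{s}}}$.
   Context: A submeasure on a complete Boolean algebra $\mathbb{B}$ is a function $\mu:\mathbb{B}\to[0,\infty)$ such that (i) $\mu(0)=0$; (ii) $a\leq b\Rightarrow\mu(a)\leq\mu(b)$; (iii) $\mu(a\vee b)\leq\mu(a)+\mu(b)$. It is strictly positive iff (iv) $a>0\Rightarrow\mu(a)>0$, and it is a Maharam (continuous) submeasure iff (v) $\lim_{n\to\infty}\mu(a_n)=0$ for each decreasing sequence $\langle a_n:n\in\omega\rangle$ in $\mathbb{B}$ with $\bigwedge_{n\in\omega}a_n=0$. A Maharam algebra is a complete Boolean algebra admitting a strictly positive Maharam submeasure. A convergence on a non-empty set $X$ is a map $\lambda:X^\omega\to P(X)$. For convergences, $\lambda_1\leq\lambda_2$ means $\lambda_1(x)\subseteq\lambda_2(x)$ for all $x\in X^\omega$. For a topology $\mathcal{O}$ on $X$, $\lim_{\mathcal{O}}$ is the convergence for which $\lim_{\mathcal{O}}(x)$ is the set of all $a\in X$ such that each neighborhood of $a$ contains all but finitely many members of the sequence $x$. For each convergence $\lambda$, $\mathcal{O}_\lambda$ denotes the (unique) maximal topology $\mathcal{O}$ on $X$ with $\lambda\leq\lim_{\mathcal{O}}$. On a complete Boolean algebra $\mathbb{B}$, for $x=\langle x_n:n\in\omega\rangle\in\mathbb{B}^\omega$ let $\liminf x=\bigvee_{k\in\omega}\bigwedge_{n\geq k}x_n$ and $\limsup x=\bigwedge_{k\in\omega}\bigvee_{n\geq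 k}x_n$, and define convergences on $\mathbb{B}$ by $\lambda_{\mathrm{ls}}(x)=\{b\in\mathbb{B}: b\geq\limsup x\}$, $\lambda_{\mathrm{li}}(x)=\{b\in\mathbb{B}: b\leq\liminf x\}$, and $\lambda_{\mathrm{s}}(x)=\{a\}$ if $\liminf x=\limsup x=a$, while $\lambda_{\mathrm{s}}(x)=\emptyset$ if $\liminf x<\limsup x$. The topology $\mathcal{O}_{\mathrm{lsi}}$ is the minimal topology on $\mathbb{B}$ containing $\mathcal{O}_{\lambda_{\mathrm{ls}}}\cup\mathcal{O}_{\lambda_{\mathrm{li}}}$. *)

(* Defs.v *)
From mathcomp Require Import all_boot all_order all_algebra.
From mathcomp Require Import all_classical all_reals all_analysis.
Import Order.TTheory GRing.Theory Num.Theory numFieldNormedType.Exports.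

Set Implicit Arguments.
Unset Strict Implicit.
Unset Printing Implicit Defensive.

Local Open Scope classical_set_scope.

(* Several topologies on one carrier are compared, so a topology is the family
   of its open sets rather than an instance of topologicalType; the axioms are
   those of the factory isOpenTopological. *)
Record is_topology (X : Type) (O : set_system X) : Prop := IsTopology {
  topology_setT : O [set: X];
  topology_setI : setI_closed O;
  topology_bigU : forall (I : Type) (f : I -> set X),
    (forall i, O (f i)) -> O (\bigcup_i f i)
}.

Definition convergence (X : Type) := (nat -> X) -> set X.

Definition conv_le (X : Type) (l1 l2 : convergence X) : Prop :=
  forall x, l1 x `<=` l2 x.

Definition lim_top (X : Type) (O : set_system X) : convergence X :=
  fun x => [set a | forall N, nbhs_of_open O a N -> \forall n \near \oo, N (x n)].

(* The greatest topology O with lam <= lim_O, written as the union of all of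
   them; conv_topologyP shows that this union is itself such a topology. *)
Definition conv_topology (X : Type) (lam : convergence X) : set_system X :=
  \bigcup_(O in [set O | is_topology O /\ conv_le lam (lim_top O)]) O.

Lemma conv_topologyP (X : Type) (lam : convergence X) :
  [/\ is_topology (conv_topology lam),
      conv_le lam (lim_top (conv_topology lam)) &
      forall O, is_topology O -> conv_le lam (lim_top O) ->
        O `<=` conv_topology lam].
Proof.
pose tau : set_system X := [set U | forall x a, lam x a -> U a ->
  \forall n \near \oo, U (x n)].
have tauT : is_topology tau.
  split=> [x a _ _|U V tU tV x a xa [Ua Va]|I f tf x a xa [i _ fia]].
  - by apply: filterS filterT => n _.
  - exact: filterI (tU x a xa Ua) (tV x a xa Va).
  - by apply: filterS (tf i x a xa fia) => n fxn; exists i.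
have taul : conv_le lam (lim_top tau).
  move=> x a xa N [U [tU Ua UN]].
  by apply: filterS (tU x a xa Ua) => n /UN.
have E : conv_topology lam = tau.
  rewrite eqEsubset; split=> [U [V [VT lV] VU] x a xa Ua|U tU].
    by apply: lV xa _ _; exists U; split.
  by exists tau.
by rewrite E; split=> // O OT lO U OU; rewrite -E; exists O.
Qed.

Section CompleteBooleanAlgebra.
Context {d : Order.disp_t} {T : ctbDistrLatticeType d}.
Implicit Types (x : nat -> T) (A : set T).

Definition csup A : T := supremum \bot%O A.
Definition cinf A : T := infimum \top%O A.

Definition bliminf x : T :=
  csup (range (fun k : nat => cinf (x @` [set n | (k <= n)%N]))).
Definition blimsup x : T :=
  cinf (range (fun k : nat => csup (x @` [set n | (k <= n)%N]))).

Definition lambda_ls : convergence T := fun x => [set b | (blimsup x <= b)%O].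
Definition lambda_li : convergence T := fun x => [set b | (b <= bliminf x)%O].
Definition lambda_s : convergence T :=
  fun x => [set a | bliminf x = a /\ blimsup x = a].

End CompleteBooleanAlgebra.

Definition lsi_topology (d : Order.disp_t) (T : ctbDistrLatticeType d)
    : set_system T :=
  smallest (@is_topology T)
    (conv_topology (@lambda_ls d T) `|` conv_topology (@lambda_li d T)).

Lemma lsi_topology_is_topology (d : Order.disp_t) (T : ctbDistrLatticeType d) :
  is_topology (@lsi_topology d T).
Proof.
split=> [W [WT _]|U V lU lV W WT|I f lf W WT].
- exact: topology_setT WT.
- by apply: (topology_setI WT.1); [exact: lU|exact: lV].
- by apply: (topology_bigU WT.1) => i; exact: lf.
Qed.

Definition complete_lattice (d : Order.disp_t) (T : porderType d) : Prop :=
  forall A : set T, supremums A !=set0 /\ infimums A !=set0.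

Section Submeasure.
Local Open Scope ring_scope.
Context {R : realType} {d : Order.disp_t} {T : ctbDistrLatticeType d}.

Record is_submeasure (mu : T -> R) : Prop := IsSubmeasure {
  submeasure_ge0 : forall a, 0 <= mu a;
  submeasure0 : mu \bot%O = 0;
  submeasure_le : forall a b, (a <= b)%O -> mu a <= mu b;
  submeasureU : forall a b, mu (a `|` b)%O <= mu a + mu b
}.

Definition strictly_positive (mu : T -> R) : Prop :=
  forall a, (\bot < a)%O -> 0 < mu a.

Definition order_continuous (mu : T -> R) : Prop :=
  forall a : nat -> T, nonincreasing_seq a -> cinf (range a) = \bot%O ->
    mu (a n) @[n --> \oo] --> (0 : R).

End Submeasure.

Definition maharam_algebra (R : realType) (d : Order.disp_t)
    (T : ctbDistrLatticeType d) : Prop :=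
  complete_lattice T /\
  exists mu : T -> R,
    [/\ is_submeasure mu, strictly_positive mu & order_continuous mu].

(* Main.v *)
(** On a Maharam algebra the sequential topology is metrized by the submeasure of
    the symmetric difference: if mu(a \ b_n) and mu(b_n \ a) are below 2^-n, then
    <b_n> converges to a algebraically, so a set open for lambda_s contains around
    each of its points a some [{b | mu(a \ b) < e} & {b | mu(b \ a) < e}].
    Continuity of mu makes the first factor open for lambda_li and the second one
    open for lambda_ls. The other inclusion holds in every complete Boolean algebra,
    because lambda_s is below both lambda_ls and lambda_li. *)
Require Import Defs.
From mathcomp Require Import all_boot all_order all_algebra.
From mathcomp Require Import all_classical all_reals all_analysis.
From mathcomp Require Import lra.
Import Order.Theory GRing.Theory Num.Theory numFieldNormedType.Exports.

Set Implicit Arguments.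
Unset Strict Implicit.
Unset Printing Implicit Defensive.

Local Open Scope classical_set_scope.

(** * Open sets of the topology induced by a convergence *)

Section ConvTopology.
Context {X : Type}.
Implicit Types (lam : convergence X) (U : set X).

Lemma conv_topology_near lam U (x : nat -> X) (a : X) :
  conv_topology lam U -> lam x a -> U a -> \forall n \near \oo, U (x n).
Proof.
have [_ llim _] := conv_topologyP lam.
by move=> oU /llim xa Ua; apply: xa; exists U; split.
Qed.

(** The sets with this property form a topology whose convergence dominates [lam], so each of them
    lies in the maximal one. Together with [conv_topology_near] this characterises openness by
    sequences. *)
Lemma conv_topologyI lam U :
  (forall x a, lam x a -> U a -> \forall n \near \oo, U (x n)) ->
  conv_topology lam U.
Proof.
move=> oU; exists [set V | forall x a, lam x a -> V a ->
    \forall n \near \oo, V (x n)]; last exact: oU.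
split=> [|x a xa N [V [oV Va VN]]]; last by apply: filterS (oV x a xa Va) => n /VN.
split=> [x a _ _|V W oV oW x a xa [Va Wa]|I f of_ x a xa [i _ fia]].
- by apply: filterS filterT => n _.
- exact: filterI (oV x a xa Va) (oW x a xa Wa).
- by apply: filterS (of_ i x a xa fia) => n fxn; exists i.
Qed.

Lemma conv_topology_le lam1 lam2 :
  Defs.conv_le lam1 lam2 -> conv_topology lam2 `<=` conv_topology lam1.
Proof.
move=> l12 U oU; apply: conv_topologyI => x a /l12.
exact: conv_topology_near.
Qed.

Lemma topology_local (O : set_system X) U :
  is_topology O -> (forall a, U a -> exists V, [/\ O V, V a & V `<=` U]) -> O U.
Proof.
move=> OT loc.
have -> : U = \bigcup_(V : {V : set X | O V /\ V `<=` U}) sval V.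
  rewrite eqEsubset; split=> [a /loc[V [OV Va VU]]|a [[V [OV VU]] _ /= /VU//]].
  by exists (exist _ V (conj OV VU)).
by apply: topology_bigU OT _ _ _ => -[V []].
Qed.

End ConvTopology.

(** * Algebraic upper and lower limits of sequences *)

Section CompleteBooleanAlgebra.
Local Open Scope order_scope.
Context {d : Order.disp_t} {T : ctbDistrLatticeType d}.
Hypothesis cT : complete_lattice T.
Implicit Types (A : set T) (x : nat -> T) (a b l z : T).

Lemma csupP A : supremums A (csup A).
Proof.
rewrite /csup /supremum; have [[s sA] _] := cT A.
(* On the empty set [supremum] returns its default value, here [\bot], which is indeed the least
   upper bound. *)
case: eqP => [->|_]; last exact: xgetPex (ex_intro _ s sA).
by split=> // u _; rewrite le0x.
Qed.

Lemma cinfP A : infimums A (cinf A).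
Proof.
rewrite /cinf /infimum; have [_ [s sA]] := cT A.
case: eqP => [->|_]; last exact: xgetPex (ex_intro _ s sA).
by split=> // u _; rewrite lex1.
Qed.

Definition tail_sup x (k : nat) : T := csup (x @` [set n | (k <= n)%N]).
Definition tail_inf x (k : nat) : T := cinf (x @` [set n | (k <= n)%N]).

Lemma tail_sup_ge x k n : (k <= n)%N -> x n <= tail_sup x k.
Proof. by move=> kn; apply: (csupP _).1; exists n. Qed.

Lemma tail_inf_le x k n : (k <= n)%N -> tail_inf x k <= x n.
Proof. by move=> kn; apply: (cinfP _).1; exists n. Qed.

Lemma tail_sup_le x k z : (forall n, (k <= n)%N -> x n <= z) -> tail_sup x k <= z.
Proof. by move=> xz; apply: (csupP _).2 => _ [n /= kn <-]; exact: xz. Qed.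

Lemma tail_inf_ge x k z : (forall n, (k <= n)%N -> z <= x n) -> z <= tail_inf x k.
Proof. by move=> xz; apply: (cinfP _).2 => _ [n /= kn <-]; exact: xz. Qed.

Lemma nonincreasing_tail_sup x : nonincreasing_seq (tail_sup x).
Proof.
by move=> j k jk; apply: tail_sup_le => n kn; apply/tail_sup_ge/(leq_trans jk).
Qed.

Lemma nondecreasing_tail_inf x : nondecreasing_seq (tail_inf x).
Proof.
by move=> j k jk; apply: tail_inf_ge => n kn; apply/tail_inf_le/(leq_trans jk).
Qed.

Lemma blimsup_le x k : blimsup x <= tail_sup x k.
Proof. by apply: (cinfP _).1; exists k. Qed.

Lemma bliminf_ge x k : tail_inf x k <= bliminf x.
Proof. by apply: (csupP _).1; exists k. Qed.

Lemma le_blimsup x z : (forall k, z <= tail_sup x k) -> z <= blimsup x.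
Proof. by move=> zx; apply: (cinfP _).2 => _ [k _ <-]; exact: zx. Qed.

Lemma bliminf_le x z : (forall k, tail_inf x k <= z) -> bliminf x <= z.
Proof. by move=> xz; apply: (csupP _).2 => _ [k _ <-]; exact: xz. Qed.

Lemma bliminf_le_blimsup x : bliminf x <= blimsup x.
Proof.
apply: bliminf_le => j; apply: le_blimsup => k.
apply: (@le_trans _ _ (x (maxn j k))).
  by apply: tail_inf_le; rewrite leq_maxl.
by apply: tail_sup_ge; rewrite leq_maxr.
Qed.

(** By residuation, limsup x \ a lies below limsup (x_n \ a), and a \ liminf x lies below limsup (a
    \ x_n). Both vanish, so limsup x <= a <= liminf x. *)
Lemma lambda_s_diff x a :
  blimsup (fun n => x n `\` a) = \bot -> blimsup (fun n => a `\` x n) = \bot ->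
  lambda_s x a.
Proof.
move=> xa0 ax0.
have sa : blimsup x <= a.
  rewrite -diff_eq0 -lex0 -xa0; apply: le_blimsup => k.
  rewrite leBLR; apply: le_trans (blimsup_le x k) _; apply: tail_sup_le => n kn.
  by rewrite -leBLR; exact: (tail_sup_ge (fun n => x n `\` a)).
have ai : a <= bliminf x.
  rewrite -diff_eq0 -lex0 -ax0; apply: le_blimsup => k.
  rewrite leBLR joinC -leBLR; apply: le_trans (bliminf_ge x k).
  apply: tail_inf_ge => n kn.
  rewrite leBLR joinC -leBLR; exact: (tail_sup_ge (fun n => a `\` x n)).
have is_ := bliminf_le_blimsup x.
split; apply/le_anti/andP; split=> //.
  exact: le_trans is_ sa.
exact: le_trans ai is_.
Qed.

Lemma lambda_s_le_ls : Defs.conv_le (@lambda_s d T) lambda_ls.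
Proof. by move=> x a [_ xa]; rewrite /lambda_ls /= xa. Qed.

Lemma lambda_s_le_li : Defs.conv_le (@lambda_s d T) lambda_li.
Proof. by move=> x a [xa _]; rewrite /lambda_li /= xa. Qed.

Lemma lsi_topology_sub : @lsi_topology d T `<=` conv_topology lambda_s.
Proof.
apply: smallest_sub; first by have [] := conv_topologyP (@lambda_s d T).
by rewrite subUset; split; apply: conv_topology_le;
  [exact: lambda_s_le_ls|exact: lambda_s_le_li].
Qed.

End CompleteBooleanAlgebra.

(** * Continuity of the submeasure, and balls around a point *)

Section MaharamSubmeasure.
Local Open Scope ring_scope.
Context {R : realType} {d : Order.disp_t} {T : ctbDistrLatticeType d}.
Hypothesis cT : complete_lattice T.
Variable mu : T -> R.
Hypothesis muS : is_submeasure mu.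
Hypothesis muC : order_continuous mu.

(** The differences c_k \ b decrease to zero, so continuity applies to them, and mu(c_k) <= mu(b) +
    mu(c_k \ b). *)
Lemma submeasure_near_lt (c : nat -> T) (b : T) (e : R) :
  nonincreasing_seq c -> (forall l, (forall k, (l <= c k)%O) -> (l <= b)%O) ->
  mu b < e -> \forall k \near \oo, mu (c k) < e.
Proof.
move=> cd cb be.
have muD0 : mu (c k `\` b)%O @[k --> \oo] --> 0.
  apply: muC => [j k jk|]; first by rewrite leBl// cd.
  have [lb _] := cinfP cT (range (fun k => c k `\` b)%O).
  set l := cinf _ in lb *.
  have {}lb k : (l <= c k `\` b)%O by apply: lb; exists k.
  have : (l <= b)%O by apply: cb => k; exact: le_trans (lb k) (leBx _ _).
  (* The element [l] is below [b] and, being below c_0 \ b, also disjoint from [b]. *)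
  move=> /meet_idPl <-; apply/eqP.
  by have := lb 0%N; rewrite leBRL => /andP[].
have be0 : 0 < e - mu b by rewrite subr_gt0.
apply: filterS (cvgr_lt _ muD0 _ be0) => k ck.
apply: (@le_lt_trans _ _ (mu b + mu (c k `\` b)%O)); last by lra.
apply: le_trans (submeasureU muS _ _).
by apply: (submeasure_le muS); rewrite -leBLR.
Qed.

(** The elements [tail_sup x k] \ a dominate x_k \ a and decrease, and their lower bounds lie below
    b \ a as soon as limsup x <= b. *)
Lemma conv_topology_ls_diff (a : T) (e : R) :
  conv_topology lambda_ls [set b | mu (b `\` a)%O < e].
Proof.
apply: conv_topologyI => x b xb /= be.
have : \forall k \near \oo, mu (tail_sup x k `\` a)%O < e.
  apply: submeasure_near_lt be => [j k jk|l lx].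
    by rewrite leBl// nonincreasing_tail_sup.
  rewrite leBRL; apply/andP; split; last first.
    by have := lx 0%N; rewrite leBRL => /andP[].
  apply: le_trans xb; apply: (le_blimsup cT) => k.
  exact: le_trans (lx k) (leBx _ _).
apply: filterS => k; apply: le_lt_trans.
by apply: (submeasure_le muS); rewrite leBl// tail_sup_ge.
Qed.

Lemma conv_topology_li_diff (a : T) (e : R) :
  conv_topology lambda_li [set b | mu (a `\` b)%O < e].
Proof.
apply: conv_topologyI => x b xb /= be.
have : \forall k \near \oo, mu (a `\` tail_inf x k)%O < e.
  apply: submeasure_near_lt be => [j k jk|l lx].
    by rewrite leBr// nondecreasing_tail_inf.
  rewrite leBRL; apply/andP; split.
    exact: le_trans (lx 0%N) (leBx _ _).
  (* Disjointness from every [tail_inf x k] passes to [b] through complements: each tail infimum is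
     below the complement of [l], hence so is liminf x, hence so is [b]. *)
  rewrite disj_leC lexC; apply: le_trans xb _.
  apply: (bliminf_le cT) => k; rewrite lexC -disj_leC.
  by have := lx k; rewrite leBRL => /andP[].
apply: filterS => k; apply: le_lt_trans.
by apply: (submeasure_le muS); rewrite leBr// tail_inf_le.
Qed.

(** The right-hand side is the exact value of the geometric sum of 2^-i over k <= i < k + m, which
    lets the induction on [m] close. *)
Lemma submeasure_joins (y : nat -> T) (k m : nat) :
  (forall n, mu (y n) < 2^-1 ^+ n) ->
  mu (\join_(k <= i < k + m) y i)%O <= 2 * 2^-1 ^+ k - 2 * 2^-1 ^+ (k + m).
Proof.
move=> muy; elim: m => [|m IH].
  by rewrite addn0 big_geq// (submeasure0 muS) subrr.
rewrite addnS big_nat_recr ?leq_addr//= exprS.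
apply: le_trans (submeasureU muS _ _) _.
by have := muy (k + m)%N; lra.
Qed.

(* The submeasure version of the Borel-Cantelli lemma. *)
Lemma submeasure_blimsup (y : nat -> T) :
  (forall n, mu (y n) < 2^-1 ^+ n) -> mu (blimsup y) = 0.
Proof.
move=> muy.
have tail k : mu (tail_sup y k) <= 2 * 2^-1 ^+ k.
  (* Subadditivity bounds only finite joins. They increase to the tail supremum, so by continuity
     the remainder has submeasure below any given [e]. *)
  apply/ler_addgt0Pr => e e0.
  pose f m := (\join_(k <= i < k + m) y i)%O.
  have : \forall m \near \oo, mu (tail_sup y k `\` f m)%O < e.
    apply: (@submeasure_near_lt _ \bot%O); last by rewrite (submeasure0 muS).
    - move=> i j ij; apply: leBr; rewrite /f.
      rewrite [leRHS](@big_cat_nat _ _ _ (k + i)) ?leq_addr ?leq_add2l//=.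
      exact: leUl.
    - move=> l lf.
      have lt : (l <= tail_sup y k)%O by exact: le_trans (lf 0%N) (leBx _ _).
      have tl : (tail_sup y k <= ~` l)%O.
        apply: (tail_sup_le cT) => n kn; rewrite lexC -disj_leC.
        (* This length makes [n] the last index of the join, so [l] is disjoint from [y n]. *)
        have := lf (n.+1 - k)%N.
        rewrite /f subnKC ?leqW// big_nat_recr//= leBRL => /andP[_ /eqP l0].
        by rewrite -lex0 -l0 leI2// leUr.
      rewrite -(meetxC l) lexI lexx /=; exact: le_trans lt tl.
  move=> [N _ /(_ N (leqnn N)) fN].
  apply: (@le_trans _ _ (mu (f N `|` (tail_sup y k `\` f N))%O)).
    by apply: (submeasure_le muS); rewrite -leBLR.
  apply: le_trans (submeasureU muS _ _) _.
  have : 0 < 2^-1 ^+ (k + N) :> R by rewrite exprn_gt0.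
  by have := submeasure_joins k N muy; rewrite -/(f N); lra.
have geo : 2 * 2^-1 ^+ k @[k --> \oo] --> (0 : R).
  by apply: (@cvg_geometric R 2 2^-1); rewrite ger0_norm; lra.
apply/le_anti; rewrite (submeasure_ge0 muS) andbT.
apply: (cvgr_to_ge geo); near=> k.
apply: le_trans (tail k); apply: (submeasure_le muS); exact: blimsup_le.
Unshelve. all: by end_near. Qed.

Hypothesis mupos : strictly_positive mu.

Lemma conv_topology_s_ball (U : set T) (a : T) :
  conv_topology lambda_s U -> U a ->
  exists2 e : R, 0 < e &
    forall b, mu (a `\` b)%O < e -> mu (b `\` a)%O < e -> U b.
Proof.
(* Without such a radius, every 2^-n gives a point x_n outside [U]; these points converge to [a] for
   [lambda_s], so they must eventually enter [U]. *)
move=> oU Ua; apply: contrapT => noball.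
have far (n : nat) : exists b,
    [/\ mu (a `\` b)%O < 2^-1 ^+ n, mu (b `\` a)%O < 2^-1 ^+ n & ~ U b].
  apply: contrapT => nob; apply: noball; exists (2^-1 ^+ n) => [|b ab ba].
    by rewrite exprn_gt0.
  by apply: contrapT => nUb; apply: nob; exists b.
have [x xP] := choice far.
have limsup0 (y : nat -> T) :
    (forall n, mu (y n) < 2^-1 ^+ n) -> blimsup y = \bot%O.
  (* Strict positivity turns a limsup of zero submeasure into a zero limsup. *)
  move=> /submeasure_blimsup muy; apply: contrapT => /eqP.
  by rewrite -lt0x => /mupos; rewrite muy ltxx.
have xa : lambda_s x a.
  by apply: (lambda_s_diff cT); apply: limsup0 => n; have [] := xP n.
have [N _ /(_ N (leqnn N))] := conv_topology_near oU xa Ua.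
by have [] := xP N.
Qed.

Lemma sub_lsi_topology : conv_topology lambda_s `<=` @lsi_topology d T.
Proof.
move=> U oU; apply: topology_local => [|a Ua].
  exact: lsi_topology_is_topology.
have [e e0 ballU] := conv_topology_s_ball oU Ua.
exists ([set b | mu (a `\` b)%O < e] `&` [set b | mu (b `\` a)%O < e]).
split=> [||b []]; last exact: ballU.
- apply: (topology_setI (lsi_topology_is_topology T)); apply: sub_gen_smallest.
    by right; exact: conv_topology_li_diff.
  by left; exact: conv_topology_ls_diff.
- by split; rewrite /= diffxx (submeasure0 muS).
Qed.

End MaharamSubmeasure.

Theorem theorem3p5 (R : realType) (d : Order.disp_t)
    (T : ctbDistrLatticeType d) (hT : @maharam_algebra R d T) :
  @lsi_topology d T = conv_topology (@lambda_s d T).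
Proof.
have [cT [mu [muS mupos muC]]] := hT.
rewrite eqEsubset; split; first exact: lsi_topology_sub.
exact: (sub_lsi_topology cT muS muC mupos).
Qed.
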